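(* Let $h,n\in\mathbb{N}$, $m=2h$, and let $u=u^*$ be an $h\times h$ matrix function locally summable on $\mathbb{R}$. Let $A$ and $S(0)=S(0)^*$ be complex $n\times n$ matrices and $\Pi(0)$ a complex $n\times m$ matrix such that $$AS(0)-S(0)A^*=\Pi(0)\,j\,\Pi(0)^*,$$ and let $\Pi(x)$ and $S(x)$ be the matrix functions on $\mathbb{R}$ which solve $$\Pi'=A\Pi q_1+\Pi q_0,\qquad S'=\Pi q_1 j\,\Pi^*$$ with the given values $\Pi(0)$ and $S(0)$ at $x=0$. Then, in the points $x$ of invertibility of $S(x)$ (and for all $t\in\mathbb{R}$), the $h\times n$ matrix function $$\psi(x,t)=\begin{bmatrix}0 & I_h\end{bmatrix}\Pi(x)^*S(x)^{-1}\mathrm{e}^{-\mathrm{i}tA}$$ satisfies the dynamical Schrödinger system $$\mathrm{i}\frac{\partial}{\partial t}\psi(x,t)=\big(\widetilde H\psi\big)(x,t),\qquad \widetilde H:=-\frac{\partial^2}{\partial x^2}+\widetilde u(x),$$ where $\widetilde u=\widetilde u^*$ is given by $$\widetilde u(x)=u(x)+2\big(X_{12}(x)+X_{21}(x)+X_{22}(x)^2\big).$$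
   Context: Notation: $I_h$ is the $h\times h$ identity matrix, $^*$ denotes conjugate transpose, and the prime denotes $d/dx$. The $m\times m$ matrices ($m=2h$) are $$j=\begin{bmatrix}0 & I_h \\ -I_h & 0\end{bmatrix},\qquad q_1=\begin{bmatrix}0 & 0 \\ I_h & 0\end{bmatrix},\qquad q_0(x)=-\begin{bmatrix}0 & I_h \\ u(x) & 0\end{bmatrix}.$$ At points where $S(x)$ is invertible, $X(x)=\Pi(x)^*S(x)^{-1}\Pi(x)$, partitioned into $h\times h$ blocks as $X(x)=\{X_{ik}(x)\}_{i,k=1}^2$. Differential equations with the locally summable coefficient $u$ are understood in the usual (Carathéodory) sense: solutions of first order systems are locally absolutely continuous, solutions of second order equations in $x$ are locally absolutely continuous together with their first $x$-derivatives, and the equations hold for almost every $x$ (in the $x$-set under consideration). *)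

(* Defs.v *)
From HB Require Import structures.
From mathcomp Require Import all_boot all_order all_algebra.
From mathcomp Require Import sesquilinear spectral.
From mathcomp Require Import complex.
From mathcomp Require Import all_classical all_reals all_analysis.

Set Implicit Arguments.
Unset Strict Implicit.
Unset Printing Implicit Defensive.

Import Order.TTheory GRing.Theory Num.Theory.
Import numFieldNormedType.Exports.

Local Open Scope classical_set_scope.
Local Open Scope ring_scope.
Local Open Scope sesquilinear_scope.

(* A property of real-valued functions, required of the real and imaginary
   part of every entry of a complex matrix function of a real variable. *)
Definition entrywise (R : realType) (P : (R -> R) -> Prop) (p q : nat)
    (F : R -> 'M[R[i]]_(p, q)) : Prop :=
  forall i j, P (fun x => complex.Re (F x i j)) /\
              P (fun x => complex.Im (F x i j)).

Definition mx_derivable (R : realType) (p q : nat)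
    (F : R -> 'M[R[i]]_(p, q)) (x : R) : Prop :=
  entrywise (fun f => derivable f x 1) F.

Definition mx_derive (R : realType) (p q : nat)
    (F : R -> 'M[R[i]]_(p, q)) (x : R) : 'M[R[i]]_(p, q) :=
  \matrix_(i, j) (derive1 (fun y => complex.Re (F y i j)) x +i*
                  derive1 (fun y => complex.Im (F y i j)) x)%C.

(* MathComp-Analysis measurability on R is Borel measurability; passing to an
   almost everywhere equal representative gives Lebesgue measurable
   functions. *)
Definition locally_summable (R : realType) (f : R -> R) : Prop :=
  exists2 g : R -> R, locally_integrable setT g &
    {ae @lebesgue_measure R, forall x, f x = g x}.

Definition absolutely_continuous (R : realType) (a b : R) (f : R -> R) : Prop :=
  forall e : R, 0 < e -> exists2 d : R, 0 < d &
    forall (N : nat) (l r : 'I_N -> R),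
      (forall k, a <= l k /\ l k <= r k /\ r k <= b) ->
      trivIset setT (fun k => `]l k, r k[%classic) ->
      \sum_(k < N) (r k - l k) < d ->
      \sum_(k < N) `|f (r k) - f (l k)| < e.

Definition mx_locally_ac (R : realType) (D : set R) (p q : nat)
    (F : R -> 'M[R[i]]_(p, q)) : Prop :=
  forall a b : R, a <= b -> `[a, b] `<=` D ->
    entrywise (absolutely_continuous a b) F.

(* Caratheodory solution on the whole line of F' = G, where the right-hand
   side G may be built from F. *)
Definition solves_ode (R : realType) (p q : nat)
    (F G : R -> 'M[R[i]]_(p, q)) : Prop :=
  mx_locally_ac setT F /\
  {ae @lebesgue_measure R, forall x, mx_derivable F x /\ mx_derive F x = G x}.

(* The sum of the exponential series, taken entry by entry. *)
Definition mx_exp (R : realType) (n : nat) (M : 'M[R[i]]_n) : 'M[R[i]]_n :=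
  let term k := (k`!%:R : R[i])^-1 *: M ^+ k in
  \matrix_(i, j) (limn (series (fun k => complex.Re (term k i j))) +i*
                  limn (series (fun k => complex.Im (term k i j))))%C.

Definition mx_j (R : realType) (h : nat) : 'M[R[i]]_(h + h) :=
  block_mx 0 1%:M (- 1%:M) 0.

Definition mx_q1 (R : realType) (h : nat) : 'M[R[i]]_(h + h) :=
  block_mx 0 0 1%:M 0.

Definition mx_q0 (R : realType) (h : nat) (u : R -> 'M[R[i]]_h) (x : R) :
    'M[R[i]]_(h + h) :=
  - block_mx 0 1%:M (u x) 0.

Definition invertibility_set (R : realType) (n : nat) (S : R -> 'M[R[i]]_n) :
    set R :=
  [set x | S x \in unitmx].

(* Meaningful on invertibility_set S only, since invmx is total. *)
Definition mx_X (R : realType) (h n : nat) (Pi : R -> 'M[R[i]]_(n, h + h))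
    (S : R -> 'M[R[i]]_n) (x : R) : 'M[R[i]]_(h + h) :=
  (Pi x)^t* *m invmx (S x) *m Pi x.

Definition u_tilde (R : realType) (h n : nat) (u : R -> 'M[R[i]]_h)
    (Pi : R -> 'M[R[i]]_(n, h + h)) (S : R -> 'M[R[i]]_n) (x : R) :
    'M[R[i]]_h :=
  let X12 := ursubmx (mx_X Pi S x) in
  let X21 := dlsubmx (mx_X Pi S x) in
  let X22 := drsubmx (mx_X Pi S x) in
  u x + 2%:R *: (X12 + X21 + X22 *m X22).

Definition psi (R : realType) (h n : nat) (A : 'M[R[i]]_n)
    (Pi : R -> 'M[R[i]]_(n, h + h)) (S : R -> 'M[R[i]]_n) (x t : R) :
    'M[R[i]]_(h, n) :=
  row_mx (0 : 'M[R[i]]_h) (1%:M : 'M[R[i]]_h) *m (Pi x)^t* *m invmx (S x) *m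
    mx_exp (- ((0 +i* 1) * t%:C)%C *: A).

Definition d_dx (R : realType) (p q : nat) (f : R -> R -> 'M[R[i]]_(p, q))
    (x t : R) : 'M[R[i]]_(p, q) :=
  mx_derive (fun y => f y t) x.

Definition d_dt (R : realType) (p q : nat) (f : R -> R -> 'M[R[i]]_(p, q))
    (x t : R) : 'M[R[i]]_(p, q) :=
  mx_derive (f x) t.

Definition schrodinger_op (R : realType) (h n : nat) (v : R -> 'M[R[i]]_h)
    (f : R -> R -> 'M[R[i]]_(h, n)) (x t : R) : 'M[R[i]]_(h, n) :=
  - d_dx (d_dx f) x t + v x *m f x t.

(* i f_t = - f_xx + v f for x in the open set D and t in R: the second
   x-derivative exists and the equation holds for almost every x in D, the
   exceptional null set being independent of t. *)
Record solves_schrodinger (R : realType) (D : set R) (h n : nat)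
    (v : R -> 'M[R[i]]_h) (f : R -> R -> 'M[R[i]]_(h, n)) : Prop := {
  schrodinger_ac : forall t, mx_locally_ac D (fun x => f x t);
  schrodinger_dx : forall x t, D x -> mx_derivable (fun y => f y t) x;
  schrodinger_dx_ac : forall t, mx_locally_ac D (fun x => d_dx f x t);
  schrodinger_dt : forall x t, D x -> mx_derivable (f x) t;
  schrodinger_eq : {ae @lebesgue_measure R, forall x, D x -> forall t,
    mx_derivable (fun y => d_dx f y t) x /\
    (0 +i* 1)%C *: d_dt f x t = schrodinger_op v f x t }
}.

(* Main.v *)
Require Import Defs.
From HB Require Import structures.
From mathcomp Require Import all_boot all_order all_algebra.
From mathcomp Require Import sesquilinear spectral.
From mathcomp Require Import complex.
From mathcomp Require Import all_classical all_reals all_analysis.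
From mathcomp Require Import ring lra.

Set Implicit Arguments.
Unset Strict Implicit.
Unset Printing Implicit Defensive.

Import Order.TTheory GRing.Theory Num.Theory.
Import numFieldNormedType.Exports.

Local Open Scope classical_set_scope.
Local Open Scope ring_scope.
Local Open Scope sesquilinear_scope.

(** Write [Pi = row_mx P1 P2], so that [P1' = A P2 - P2 u], [P2' = - P1] and
    [S' = P2 P2^*], and put [Y_i = P_i^* S^-1] where [S] is invertible. Then
    [X_ik = Y_i P_k] and [psi = Y2 exp(-itA)], and the product rule gives
<<
      Y2' = - (Y1 + X22 Y2),
      Y1' = P2^* A^* S^-1 - u Y2 - X12 Y2,
      X22' = - X12 - X21 - X22^2.
>>
    The identity [A S - S A^* = Pi j Pi^*], given at 0, persists because its two
    sides have the same derivative almost everywhere; multiplied by [S^-1] on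
    both sides it reads
    [A^* S^-1 = S^-1 A - S^-1 P1 Y2 + S^-1 P2 Y1], which removes [A^*] from
    [Y1']. Differentiating [Y2'] once more, everything collapses to
    [- Y2'' + u_tilde Y2 = Y2 A] ([schrodinger_algebra]). As
    [exp(-itA)' = -iA exp(-itA)], the right-hand side times [exp(-itA)] is
    [i psi_t].

    The analytic point is that [u] is merely locally summable, so [P1] solves
    its equation almost everywhere only, whereas [Y2'] has to exist at every
    point and to be absolutely continuous. Both this and the persistence of the
    identity follow from one estimate ([ac_increment]): an absolutely continuous
    function with [|f'| <= c] almost everywhere satisfies
    [|f b - f a| <= c (b - a)]. With [c = 0] it yields constancy, and applied to
    [f - g(x) id] near [x] it shows that a function whose almost everywhere
    derivative [g] is continuous is differentiable everywhere
    ([ac_is_derive]); this applies to [P2] and [S]. Closure of absolute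
    continuity and of derivability under matrix operations, inversion included,
    is proved once for both ([function_algebra]). *)

(** * Increments of absolutely continuous functions *)

(** Induction along an interval: the points reached from [a] have a supremum,
    and the step available there carries a nearby reached point past it, unless
    it is [b]. It replaces the choice of a finite subdivision compatible with a
    gauge. *)
Lemma real_induction (R : realType) (a b : R) (P : R -> Prop) : a <= b ->
  P a ->
  (forall x, a <= x <= b -> exists2 d : R, 0 < d &
     forall y z, a <= y <= x -> x <= z <= b -> x - d < y -> z < x + d ->
       P y -> P z) ->
  P b.
Proof.
move=> ab Pa step.
pose E := [set x | a <= x <= b /\ P x].
have Ea : E a by split=> //; rewrite lexx.
have supE : has_sup E.
  by split; [exists a | exists b => x [/andP[]]].
have s_ab : a <= sup E <= b.
  apply/andP; split; first exact: (ub_le_sup supE.2).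
  by apply: ge_sup => [|x [/andP[]]//]; exists a.
have [d d0 dP] := step _ s_ab.
have [y [y_ab Py] ysup] := sup_adherent d0 supE.
have ys : y <= sup E by apply: (ub_le_sup supE.2).
pose z := Num.min b (sup E + d / 2).
have z_b : z <= b by rewrite ge_min lexx.
have sz : sup E <= z.
  by rewrite le_min (andP s_ab).2 /= lerDl divr_ge0 // ltW.
have zd : z < sup E + d.
  by rewrite gt_min ltrD2l ltr_pdivrMr // ltr_pMr // ltr1n orbT.
have Pz : P z.
  apply: (dP y) => //; first by rewrite (andP y_ab).1.
  by rewrite sz.
have zs : z <= sup E.
  apply: (ub_le_sup supE.2); split=> //; rewrite z_b andbT.
  exact: le_trans (andP s_ab).1 sz.
move: zs Pz; rewrite /z ge_min; case/orP => [bs|]; last first.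
  by rewrite gerDl leNgt divr_gt0.
have -> // : Num.min b (sup E + d / 2) = b.
apply/min_idPl; apply: le_trans bs _.
by rewrite lerDl divr_ge0 // ltW.
Qed.

(** The difference quotient is controlled over all small intervals around [x],
    not only over those starting at [x], since the increment splits at [x]. *)
Lemma derivable_straddle (R : realType) (f : R -> R) (x c e : R) :
  derivable f x 1 -> `|derive1 f x| <= c -> 0 < e ->
  exists2 d : R, 0 < d & forall y z, y <= x <= z -> x - d < y -> z < x + d ->
    `|f z - f y| <= (c + e) * (z - y).
Proof.
move=> df fc e0.
have /cvgrPdist_lt/(_ _ e0) : h^-1 *: ((f \o shift x) (h *: (1 : R)) - f x)
    @[h --> 0^'] --> derive1 f x.
  by rewrite derive1E; exact: df.
case=> d /= d0 dP.
have near_x w : `|w - x| < d -> `|f w - f x| <= (c + e) * `|w - x|.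
  have [->|wx] := eqVneq w x; first by rewrite !subrr normr0 mulr0.
  move=> wd; have wx0 : w - x != 0 by rewrite subr_eq0.
  have := dP (w - x); rewrite /= sub0r normrN => /(_ wd wx0).
  rewrite /= [_ *: 1]mulr1 subrK distrC => lt_e.
  rewrite -ler_pdivrMr ?normr_gt0 // -normfV -normrM mulrC.
  rewrite -[_ * _](subrK (derive1 f x)); apply: le_trans (ler_normD _ _) _.
  by rewrite addrC lerD // ltW.
exists d => // y z /andP[yx xz] xdy zxd.
have -> : f z - f y = (f z - f x) - (f y - f x) by ring.
apply: le_trans (ler_normB _ _) _.
have -> : (c + e) * (z - y) = (c + e) * (z - x) + (c + e) * (x - y) by ring.
have hz := near_x z; have hy := near_x y.
rewrite ger0_norm ?subr_ge0 // in hz.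
rewrite (distrC y x) ger0_norm ?subr_ge0 // in hy.
by rewrite lerD //; [apply: hz | apply: hy]; lra.
Qed.

Lemma sum_length_le (R : realType) (U : set R) (N : nat) (l r : 'I_N -> R) :
  measurable U -> (forall k, l k <= r k) ->
  trivIset setT (fun k => `]l k, r k[%classic) ->
  (forall k, `]l k, r k[ `<=` U) ->
  ((\sum_(k < N) (r k - l k))%:E <= lebesgue_measure U)%E.
Proof.
move=> mU lr tI sub.
have mI k : measurable (`]l k, r k[%classic : set R) by [].
have mB : measurable (\big[setU/set0]_(k < N) `]l k, r k[%classic : set R).
  by apply: bigsetU_measurable.
have mu_itv k :
    lebesgue_measure (`]l k, r k[%classic : set R) = (r k - l k)%:E.
  rewrite lebesgue_measure_itv /= lte_fin.
  by have := lr k; rewrite le_eqVlt => /orP[/eqP->|->//]; rewrite ltxx subrr.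
have -> : (\sum_(k < N) (r k - l k))%:E =
    lebesgue_measure (\big[setU/set0]_(k < N) `]l k, r k[%classic : set R).
  rewrite -sumEFin.
  transitivity (\sum_(k < N)
    lebesgue_measure (`]l k, r k[%classic : set R))%E.
    by apply: eq_bigr => k _; rewrite mu_itv.
  by apply/esym/measure_semi_additive_ord.
apply: le_measure; rewrite ?inE //.
by elim/big_ind: _ => // X Y XU YU; rewrite subUset.
Qed.

(** Cover the exceptional null set by an open [U] of small measure. Going from
    [a] to [b], a step around a point of derivability grows by at most
    [(c + e) * length], and a step around an exceptional point stays inside [U].
    The latter steps are disjoint with small total length, so absolute
    continuity makes their contribution negligible. *)
Lemma ac_increment (R : realType) (f : R -> R) (a b c : R) : a <= b -> 0 <= c ->
  absolutely_continuous a b f ->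
  {ae @lebesgue_measure R, forall x, a <= x <= b ->
     derivable f x 1 /\ `|derive1 f x| <= c} ->
  `|f b - f a| <= c * (b - a).
Proof.
move=> ab c0 acf [N [mN N0 fN]].
apply/ler_addgt0Pr => e e0.
have k0 : 0 < b - a + 1 by lra.
pose e1 := e / (b - a + 1); have e10 : 0 < e1 by rewrite divr_gt0.
have -> : c * (b - a) + e = (c + e1) * (b - a) + e1.
  by rewrite /e1; field; rewrite gt_eqF.
have [d d0 acfd] := acf _ e10.
have [U [oU NU UNd]] :=
  lebesgue_regularity_outer mN (eq_ind_r (fun z => (z < +oo)%E) (ltry 0) N0) d0.
have mU : measurable U by exact: measurable_realfun.open_measurable.
have Ud : (lebesgue_measure U < d%:E)%E.
  rewrite -(setDUK NU); apply: le_lt_trans UNd.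
  have mD : measurable (U `\` N) by exact: measurableD.
  by apply: (le_trans (measureU2 _ mN mD)); rewrite [X in (X + _)%E]N0 add0e.
(* P x: up to x, the growth of f in excess of slope c + e1 is carried by
   finitely many disjoint intervals inside U *)
pose P x := exists (M : nat) (l r : nat -> R),
  [/\ forall k, (k < M)%N -> a <= l k /\ l k <= r k /\ r k <= x,
      forall k k', (k < k' < M)%N -> r k <= l k',
      forall k, (k < M)%N -> `]l k, r k[ `<=` U &
      `|f x - f a| <=
        (c + e1) * (x - a) + \sum_(k < M) `|f (r k) - f (l k)|].
have [M [l [r [lr disj sub le_f]]]] : P b.
  apply: (real_induction ab).
    exists 0%N, (fun=> 0), (fun=> 0); split => //.
    by rewrite big_ord0 !subrr normr0 mulr0 addr0.
  move=> x x_ab; have [xN|xN] := pselect (N x).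
    have [r0 /= r00 rU] : exists2 r0 : R, 0 < r0 & ball x r0 `<=` U.
      have := oU x (NU _ xN); rewrite nbhs_ballP => -[r0 /= ? ?].
      by exists r0.
    exists r0 => // y z /andP[ay yx] /andP[xz zb] xy zx.
    move=> [M [l [r [lr disj sub le_f]]]].
    exists M.+1, (fun k => if (k < M)%N then l k else y),
      (fun k => if (k < M)%N then r k else z); split.
    - move=> k _; case: ifP => [/lr [? [? ?]]|_]; last by split=> //; lra.
      by split=> //; split=> //; lra.
    - move=> k k' /andP[kk' k'M]; have kM := leq_trans kk' k'M.
      rewrite kM; case: ifP => k'M'; first by apply: disj; rewrite kk'.
      by have [_ []] := lr _ kM.
    - move=> k kM; case: ifP => kM'; first exact: sub.
      move=> w /=; rewrite in_itv /= => /andP[yw wz].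
      by apply: rU; rewrite /ball /= ltr_norml; lra.
    - rewrite big_ord_recr /= ltnn.
      under eq_bigr do rewrite ltn_ord.
      have -> : f z - f a = (f z - f y) + (f y - f a) by ring.
      apply: le_trans (ler_normD _ _) _.
      have : (c + e1) * (y - a) <= (c + e1) * (z - a).
        by rewrite ler_wpM2l //; lra.
      lra.
  have [df fc] : derivable f x 1 /\ `|derive1 f x| <= c.
    by apply: contrapT => H; apply: xN; apply: fN => /(_ x_ab).
  have [r0 r00 fr0] := derivable_straddle df fc e10.
  exists r0 => // y z /andP[ay yx] /andP[xz zb] xy zx.
  move=> [M [l [r [lr disj sub le_f]]]].
  exists M, l, r; split=> //.
    by move=> k /lr [? [? ?]]; split=> //; split=> //; lra.
  have -> : f z - f a = (f z - f y) + (f y - f a) by ring.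
  apply: le_trans (ler_normD _ _) _.
  have := fr0 y z; rewrite yx xz => /(_ isT xy zx).
  have -> : (c + e1) * (z - a) = (c + e1) * (z - y) + (c + e1) * (y - a).
    by ring.
  lra.
apply: le_trans le_f _; rewrite lerD2l ltW //.
have lr' (k : 'I_M) : l k <= r k by have [_ []] := lr _ (ltn_ord k).
have tI : trivIset setT (fun k : 'I_M => `]l k, r k[%classic).
  apply/trivIsetP => i j _ _ ij; rewrite -subset0 => w [] /=.
  rewrite !in_itv /= => /andP[lw wr] /andP[lw' wr'].
  have : (i < j)%N || (j < i)%N by rewrite -neq_ltn.
  case/orP => ltij.
    by have := disj i j; rewrite ltij ltn_ord => /(_ isT); lra.
  by have := disj j i; rewrite ltij ltn_ord => /(_ isT); lra.
apply: (acfd M l r) => //; first by move=> k; apply: lr.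
rewrite -lte_fin; apply: le_lt_trans Ud; apply: sum_length_le => // k.
exact: sub.
Qed.

(** * Calculus of absolutely continuous functions *)

(* Stated for [lebesgue_measure] as elaborated inside [{ae _, _}], where
   instance resolution does not recover the measure structure. *)
#[local] Instance ae_lebesgue_filter (R : realType) :
  Filter (nbhs (almost_everywhere (@lebesgue_measure R))).
Proof. exact: (ae_filter_ringOfSetsType (@lebesgue_measure R)). Qed.

(** All closure properties of absolute continuity come from this comparison of
    increments. *)
Lemma ac_dominated (R : realType) (a b K : R) (f1 f2 g : R -> R) : 0 < K ->
  absolutely_continuous a b f1 -> absolutely_continuous a b f2 ->
  (forall x y, a <= x <= b -> a <= y <= b ->
     `|g y - g x| <= K * (`|f1 y - f1 x| + `|f2 y - f2 x|)) ->
  absolutely_continuous a b g.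
Proof.
move=> K0 ac1 ac2 gK e e0.
have e'0 : 0 < e / K / 2 by rewrite !divr_gt0.
have [d1 d10 P1] := ac1 _ e'0; have [d2 d20 P2] := ac2 _ e'0.
exists (Num.min d1 d2); first by rewrite lt_min d10.
move=> N l r lr tI; rewrite lt_min => /andP[lt1 lt2].
apply: (@le_lt_trans _ _ (K *
  (\sum_(k < N) `|f1 (r k) - f1 (l k)| + \sum_(k < N) `|f2 (r k) - f2 (l k)|))).
  rewrite -big_split /= mulr_sumr; apply: ler_sum => k _.
  by have [? [? ?]] := lr k; apply: gK; apply/andP; split=> //; lra.
rewrite -ltr_pdivlMl // mulrC [ltRHS](splitr (e / K)).
by apply: ltrD; [apply: P1 | apply: P2].
Qed.

Lemma ac_uniformly_continuous (R : realType) (a b : R) (f : R -> R) :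
  absolutely_continuous a b f -> forall e, 0 < e -> exists2 d : R, 0 < d &
    forall x y, a <= x <= b -> a <= y <= b -> `|x - y| < d ->
      `|f x - f y| < e.
Proof.
move=> acf e e0; have [d d0 dP] := acf e e0; exists d => // x y.
wlog xy : x y / y <= x => [hw|].
  have [|/ltW] := leP y x; first exact: hw.
  by move=> xy ? ?; rewrite (distrC x) (distrC (f x)); apply: hw.
move=> x_ab y_ab; rewrite ger0_norm ?subr_ge0 // => xyd.
have := dP 1%N (fun=> y) (fun=> x); rewrite !big_ord1; apply=> //.
  by move=> _; split=> //; lra.
by move=> i j _ _ _; rewrite !ord1.
Qed.

Lemma ac_within_continuous (R : realType) (a b : R) (f : R -> R) :
  absolutely_continuous a b f -> {within `[a, b], continuous f}.
Proof.
move=> acf; apply/subspace_continuousP => x /=; rewrite in_itv /= => x_ab.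
apply/cvgrPdist_lt => e e0.
have [d d0 dP] := ac_uniformly_continuous acf e0.
rewrite near_withinE; exists d => //= y /= xy; rewrite in_itv /= => y_ab.
exact: dP.
Qed.

Lemma ac_norm (R : realType) (a b : R) (f : R -> R) :
  absolutely_continuous a b f -> absolutely_continuous a b (fun x => `|f x|).
Proof.
move=> acf; apply: (ac_dominated ltr01 acf acf) => x y _ _.
rewrite mul1r; apply: le_trans (ler_dist_dist _ _) _.
by rewrite lerDl.
Qed.

Lemma ac_bounded (R : realType) (a b : R) (f : R -> R) : a <= b ->
  absolutely_continuous a b f ->
  exists2 M : R, 0 < M & forall x, a <= x <= b -> `|f x| <= M.
Proof.
move=> ab acf.
have [c _ cP] := EVT_max ab (ac_within_continuous (ac_norm acf)).
exists (`|f c| + 1); first by rewrite ltr_wpDl.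
move=> x x_ab; apply: le_trans (cP x _) _; first by rewrite in_itv.
by rewrite lerDl.
Qed.

Lemma ac_bounded_away (R : realType) (a b : R) (f : R -> R) : a <= b ->
  absolutely_continuous a b f -> (forall x, a <= x <= b -> f x != 0) ->
  exists2 m : R, 0 < m & forall x, a <= x <= b -> m <= `|f x|.
Proof.
move=> ab acf f0.
have [c] := EVT_min ab (ac_within_continuous (ac_norm acf)).
rewrite in_itv => c_ab cP.
exists `|f c|; first by rewrite normr_gt0 f0.
by move=> x x_ab; apply: cP; rewrite in_itv.
Qed.

Lemma ac_eq_on (R : realType) (a b : R) (f g : R -> R) :
  (forall x, a <= x <= b -> f x = g x) ->
  absolutely_continuous a b f -> absolutely_continuous a b g.
Proof.
move=> fg acf; apply: (ac_dominated ltr01 acf acf) => x y x_ab y_ab.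
by rewrite mul1r !fg // lerDl.
Qed.

Lemma ac_continuous (R : realType) (f : R -> R) :
  (forall a b, a <= b -> absolutely_continuous a b f) -> continuous f.
Proof.
move=> acf x; apply/cvgrPdist_lt => e e0.
have /acf/ac_uniformly_continuous/(_ e e0)[d d0 dP] : x - 1 <= x + 1 by lra.
exists (Num.min d 1); first by rewrite /= lt_min d0 ltr01.
move=> y /=; rewrite lt_min => /andP[yd y1]; apply: dP => //; first by lra.
by move: y1; rewrite distrC ltr_norml; lra.
Qed.

(** Absolute continuity on an interval and derivability at a point share these
    closure properties; [D] is where a function must not vanish for its inverse
    to stay in the class. *)
Record function_algebra (R : realType) (D : set R) (P : (R -> R) -> Prop) :
  Prop := FunctionAlgebra {
  fa_cst : forall c, P (fun=> c);
  fa_add : forall f g, P f -> P g -> P (fun x => f x + g x);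
  fa_mul : forall f g, P f -> P g -> P (fun x => f x * g x);
  fa_inv : forall f, P f -> (forall x, D x -> f x != 0) ->
    P (fun x => (f x)^-1)
}.

Lemma ac_function_algebra (R : realType) (a b : R) : a <= b ->
  function_algebra `[a, b] (absolutely_continuous a b).
Proof.
move=> ab; split.
- move=> c e e0; exists 1 => // N l r _ _ _.
  by rewrite big1 // => k _; rewrite subrr normr0.
- move=> f g acf acg; apply: (ac_dominated ltr01 acf acg) => x y _ _.
  by rewrite mul1r opprD addrACA ler_normD.
- move=> f g acf acg.
  have [M M0 fM] := ac_bounded ab acf; have [M' M'0 gM] := ac_bounded ab acg.
  apply: (ac_dominated (addr_gt0 M0 M'0) acf acg) => x y x_ab y_ab.
  have -> : f y * g y - f x * g x = (f y - f x) * g y + f x * (g y - g x).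
    by ring.
  apply: le_trans (ler_normD _ _) _; rewrite !normrM.
  have h1 := ler_wpM2l (normr_ge0 (f y - f x)) (gM _ y_ab).
  have h2 := ler_wpM2r (normr_ge0 (g y - g x)) (fM _ x_ab).
  have h3 := mulr_ge0 (ltW M0) (normr_ge0 (f y - f x)).
  have h4 := mulr_ge0 (ltW M'0) (normr_ge0 (g y - g x)).
  lra.
- move=> f acf f0.
  have {}f0 x : a <= x <= b -> f x != 0.
    by move=> x_ab; apply: f0; rewrite /= in_itv.
  have [m m0 fm] := ac_bounded_away ab acf f0.
  have K0 : 0 < (m ^+ 2)^-1 by rewrite invr_gt0 exprn_gt0.
  apply: (ac_dominated K0 acf acf) => x y x_ab y_ab.
  have -> : (f y)^-1 - (f x)^-1 = (f x * f y)^-1 * (f x - f y).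
    by field; rewrite !f0.
  rewrite normrM distrC; apply: ler_pM => //; last by rewrite lerDl.
  rewrite normfV lef_pV2 ?posrE ?normr_gt0 ?mulf_neq0 ?f0 ?exprn_gt0 //.
  by rewrite normrM expr2 ler_pM ?fm // ltW.
Qed.

Lemma derivable_function_algebra (R : realType) (x : R) :
  function_algebra [set x] (fun f => derivable f x 1).
Proof.
split.
- by move=> c; apply: derivable_cst.
- by move=> f g; apply: derivableD.
- by move=> f g; apply: derivableM.
- by move=> f df f0; apply: derivableV => //; apply: f0.
Qed.

(** Subtracting [g x * z] from [f z] leaves an absolutely continuous function
    whose derivative is almost everywhere small near [x], to which the increment
    estimate applies. *)
Lemma ac_is_derive (R : realType) (f g : R -> R) (x : R) :
  (forall a b, a <= b -> absolutely_continuous a b f) ->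
  {ae @lebesgue_measure R, forall y, derivable f y 1 /\ derive1 f y = g y} ->
  {for x, continuous g} -> is_derive x 1 f (g x).
Proof.
move=> acf aef cg.
pose k z := f z + - g x * z.
have ack a b : a <= b -> absolutely_continuous a b k.
  move=> ab; have FA := ac_function_algebra ab.
  apply: (fa_add FA); first exact: acf.
  apply: (fa_mul FA); first exact: (fa_cst FA).
  move=> e e0; exists e => // N l r lr _; apply: le_lt_trans.
  by apply: ler_sum => i _; rewrite ger0_norm // subr_ge0; have [_ []] := lr i.
have slope e : 0 < e -> exists2 d, 0 < d &
    forall y, `|y - x| < d -> `|k y - k x| <= e * `|y - x|.
  move=> e0; have /cvgrPdist_lt/(_ e e0)[d /= d0 dP] := cg.
  exists d => // y yd.
  have aek a b : `|a - x| < d -> `|b - x| < d ->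
      {ae @lebesgue_measure R, forall z, a <= z <= b ->
        derivable k z 1 /\ `|derive1 k z| <= e}.
    move=> ad bd; move: aef; apply: filterS => z [df fz] z_ab.
    have dk : is_derive z 1 k (g z - g x).
      have ? : is_derive z 1 f (g z).
        by rewrite -fz derive1E; apply/derivableP.
      have -> : g z - g x = g z + (- g x *: 1) by rewrite [_ *: _]mulr1.
      rewrite (_ : k = f + (- g x) *: id); last by apply/funext.
      exact: is_deriveD.
    split; first exact: ex_derive.
    rewrite derive1E derive_val ltW // distrC; apply: dP => /=.
    by move: ad bd; rewrite distrC !ltr_norml; lra.
  have xd : `|x - x| < d by rewrite subrr normr0.
  have [xy|/ltW yx] := leP x y.
    rewrite [`|y - x|]ger0_norm ?subr_ge0 //.
    exact: ac_increment (ltW e0) (ack _ _ xy) (aek _ _ xd yd).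
  rewrite distrC [`|y - x|]distrC [`|x - y|]ger0_norm ?subr_ge0 //.
  exact: ac_increment (ltW e0) (ack _ _ yx) (aek _ _ yd xd).
have cv : h^-1 *: ((f \o shift x) (h *: (1 : R)) - f x) @[h --> 0^'] --> g x.
  apply/cvgrPdist_le => e e0; have [d d0 dP] := slope e e0.
  exists d => //= h /=; rewrite sub0r normrN => hd h0.
  have := dP (h + x); rewrite addrK => /(_ hd).
  rewrite [h *: 1]mulr1 /k distrC -ler_pdivrMr ?normr_gt0 // -normfV -normrM.
  congr (`|_| <= _); rewrite /= [_ *: _]mulrC; field.
  by [].
split; first by apply/cvg_ex; exists (g x).
exact: cvg_lim cv.
Qed.

(** * Entrywise regularity of complex matrix functions *)

Section ComplexEntries.
Variables (R : realType) (D : set R) (P : (R -> R) -> Prop).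
Hypothesis FA : function_algebra D P.

Let cplx (f : R -> R[i]) : Prop :=
  P (fun x => complex.Re (f x)) /\ P (fun x => complex.Im (f x)).

Let opp f : P f -> P (fun x => - f x).
Proof.
move=> Pf; rewrite (_ : (fun x => - f x) = (fun x => -1 * f x)).
  exact: (fa_mul FA (fa_cst FA _)).
by apply/funext => x; rewrite mulN1r.
Qed.

Let cplx_cst c : cplx (fun=> c).
Proof. by split; apply: (fa_cst FA). Qed.

Let cplx_add f g : cplx f -> cplx g -> cplx (fun x => f x + g x).
Proof.
move=> [rf mf] [rg mg]; split.
  rewrite (_ : (fun x => _) = (fun x => complex.Re (f x) + complex.Re (g x))).
    exact: (fa_add FA).
  by apply/funext => x; case: (f x); case: (g x).
rewrite (_ : (fun x => _) = (fun x => complex.Im (f x) + complex.Im (g x))).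
  exact: (fa_add FA).
by apply/funext => x; case: (f x); case: (g x).
Qed.

Let cplx_mul f g : cplx f -> cplx g -> cplx (fun x => f x * g x).
Proof.
move=> [rf mf] [rg mg]; split.
  rewrite (_ : (fun x => _) = (fun x => complex.Re (f x) * complex.Re (g x) +
      - (complex.Im (f x) * complex.Im (g x)))).
    by apply: (fa_add FA); [|apply: opp]; apply: (fa_mul FA).
  by apply/funext => x; case: (f x); case: (g x).
rewrite (_ : (fun x => _) = (fun x => complex.Re (f x) * complex.Im (g x) +
    complex.Im (f x) * complex.Re (g x))).
  by apply: (fa_add FA); apply: (fa_mul FA).
by apply/funext => x; case: (f x); case: (g x).
Qed.

Let cplx_conj f : cplx f -> cplx (fun x => (f x)^*).
Proof.
move=> [rf mf]; split.
  rewrite (_ : (fun x => _) = (fun x => complex.Re (f x))) //.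
  by apply/funext => x; case: (f x).
rewrite (_ : (fun x => _) = (fun x => - complex.Im (f x))); first exact: opp.
by apply/funext => x; case: (f x).
Qed.

Let cplx_inv f : cplx f -> (forall x, D x -> f x != 0) ->
  cplx (fun x => (f x)^-1).
Proof.
move=> [rf mf] f0.
pose n2 x := complex.Re (f x) * complex.Re (f x) +
  complex.Im (f x) * complex.Im (f x).
have Pn2 : P (fun x => (n2 x)^-1).
  apply: (fa_inv FA); first by apply: (fa_add FA); apply: (fa_mul FA).
  move=> x /f0; apply: contra; rewrite /n2 -!expr2.
  rewrite paddr_eq0 ?sqr_ge0 // !sqrf_eq0 => /andP[].
  by case: (f x) => a b /= /eqP -> /eqP ->.
split.
  rewrite (_ : (fun x => _) = (fun x => complex.Re (f x) * (n2 x)^-1)).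
    exact: (fa_mul FA).
  by apply/funext => x; rewrite /n2 -!expr2; case: (f x).
rewrite (_ : (fun x => _) = (fun x => - (complex.Im (f x) * (n2 x)^-1))).
  by apply: opp; apply: (fa_mul FA).
by apply/funext => x; rewrite /n2 -!expr2; case: (f x).
Qed.

Let cplx_sum (I : Type) (r : seq I) (Q : pred I) (f : I -> R -> R[i]) :
  (forall i, cplx (f i)) -> cplx (fun x => \sum_(i <- r | Q i) f i x).
Proof.
move=> cf; elim: r => [|i r IH].
  rewrite (_ : (fun x => _) = (fun=> 0)) //.
  by apply/funext => x; rewrite big_nil.
have [Qi|Qi] := boolP (Q i); last first.
  rewrite (_ : (fun x => _) = (fun x => \sum_(j <- r | Q j) f j x)) //.
  by apply/funext => x; rewrite big_cons (negbTE Qi).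
rewrite (_ : (fun x => _) = (fun x => f i x + \sum_(j <- r | Q j) f j x)).
  exact: cplx_add.
by apply/funext => x; rewrite big_cons Qi.
Qed.

Let cplx_prod (I : Type) (r : seq I) (f : I -> R -> R[i]) :
  (forall i, cplx (f i)) -> cplx (fun x => \prod_(i <- r) f i x).
Proof.
move=> cf; elim: r => [|i r IH].
  rewrite (_ : (fun x => _) = (fun=> 1)) //.
  by apply/funext => x; rewrite big_nil.
rewrite (_ : (fun x => _) = (fun x => f i x * \prod_(j <- r) f j x)).
  exact: cplx_mul.
by apply/funext => x; rewrite big_cons.
Qed.

Let entrywise_eq p q (F G : R -> 'M[R[i]]_(p, q)) :
  (forall x, F x = G x) -> entrywise P F -> entrywise P G.
Proof. by move=> FG; rewrite (_ : F = G) //; apply/funext. Qed.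

Let entrywiseE p q (F : R -> 'M[R[i]]_(p, q)) (f : 'I_p -> 'I_q -> R -> R[i]) :
  (forall i j x, F x i j = f i j x) -> (forall i j, cplx (f i j)) ->
  entrywise P F.
Proof.
move=> Ff cf i j; have := cf i j; rewrite /cplx.
by rewrite (_ : f i j = (fun x => F x i j)) //; apply/funext => x; rewrite Ff.
Qed.

Lemma entrywise_cst p q (M : 'M[R[i]]_(p, q)) : entrywise P (fun=> M).
Proof. by move=> i j; apply: cplx_cst. Qed.

Lemma entrywise_add p q (F G : R -> 'M[R[i]]_(p, q)) :
  entrywise P F -> entrywise P G -> entrywise P (fun x => F x + G x).
Proof.
move=> PF PG; apply: (@entrywiseE _ _ _ (fun i j x => F x i j + G x i j)).
  by move=> i j x; rewrite mxE.
by move=> i j; apply: cplx_add; [apply: PF | apply: PG].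
Qed.

Lemma entrywise_opp p q (F : R -> 'M[R[i]]_(p, q)) :
  entrywise P F -> entrywise P (fun x => - F x).
Proof.
move=> PF; apply: (@entrywiseE _ _ _ (fun i j x => -1 * F x i j)).
  by move=> i j x; rewrite mxE mulN1r.
by move=> i j; apply: cplx_mul; [apply: cplx_cst | apply: PF].
Qed.

Lemma entrywise_mulmx p q r (F : R -> 'M[R[i]]_(p, q))
    (G : R -> 'M[R[i]]_(q, r)) :
  entrywise P F -> entrywise P G -> entrywise P (fun x => F x *m G x).
Proof.
move=> PF PG.
apply: (@entrywiseE _ _ _ (fun i k x => \sum_j F x i j * G x j k)).
  by move=> i j x; rewrite mxE.
move=> i k; apply: cplx_sum => j.
by apply: cplx_mul; [apply: PF | apply: PG].
Qed.

Lemma entrywise_adjoint p q (F : R -> 'M[R[i]]_(p, q)) :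
  entrywise P F -> entrywise P (fun x => (F x)^t*).
Proof.
move=> PF; apply: (@entrywiseE _ _ _ (fun i j x => (F x j i)^*)).
  by move=> i j x; rewrite !mxE.
by move=> i j; apply: cplx_conj; apply: PF.
Qed.

Lemma entrywise_mxsub p q p' q' (f : 'I_p' -> 'I_p) (g : 'I_q' -> 'I_q)
    (F : R -> 'M[R[i]]_(p, q)) :
  entrywise P F -> entrywise P (fun x => mxsub f g (F x)).
Proof.
move=> PF; apply: (@entrywiseE _ _ _ (fun i j x => F x (f i) (g j))).
  by move=> i j x; rewrite !mxE.
by move=> i j; apply: PF.
Qed.

Let cplx_det p (F : R -> 'M[R[i]]_p) :
  entrywise P F -> cplx (fun x => \det (F x)).
Proof.
move=> PF; apply: cplx_sum => s; apply: cplx_mul; first exact: cplx_cst.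
by apply: cplx_prod => i; apply: PF.
Qed.

Lemma entrywise_det p (F : R -> 'M[R[i]]_p) :
  entrywise P F -> entrywise P (fun x => (\det (F x))%:M : 'M[R[i]]_1).
Proof.
move=> PF; apply: (@entrywiseE _ _ _ (fun i j x => \det (F x))).
  by move=> i j x; rewrite !ord1 mxE eqxx.
by move=> i j; apply: cplx_det.
Qed.

(** Cramer's rule keeps the class: the explicit right-hand side stands for
    [invmx], which is given by that formula at invertible matrices only. *)
Lemma entrywise_cramer p (F : R -> 'M[R[i]]_p) :
  entrywise P F -> (forall x, D x -> F x \in unitmx) ->
  entrywise P (fun x => (\det (F x))^-1 *: \adj (F x)).
Proof.
move=> PF Fu.
apply: (@entrywiseE _ _ _ (fun i j x => (\det (F x))^-1 * (\adj (F x)) i j)).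
  by move=> i j x; rewrite mxE.
move=> i j; apply: cplx_mul.
  by apply: cplx_inv; [apply: cplx_det | move=> x /Fu; rewrite unitmxE unitfE].
have : entrywise P (fun x => \adj (F x)); last by move=> /(_ i j).
apply: (@entrywiseE _ _ _ (fun i j x =>
  (-1) ^+ (j + i) * \det (row' j (col' i (F x))))).
  by move=> {}i {}j x; rewrite mxE.
move=> {}i {}j; apply: cplx_mul; first exact: cplx_cst.
apply: cplx_det.
apply: (@entrywiseE _ _ _ (fun k l x => F x (lift j k) (lift i l))).
  by move=> k l x; rewrite !mxE.
by move=> k l; apply: PF.
Qed.

End ComplexEntries.

Lemma cramer_invmx (R : realType) n (M : 'M[R[i]]_n) : M \in unitmx ->
  (\det M)^-1 *: \adj M = invmx M.
Proof. by rewrite /invmx => ->. Qed.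

(** * Derivatives of matrix functions *)

Lemma cReM (R : realType) (z w : R[i]) : complex.Re (z * w) =
  complex.Re z * complex.Re w - complex.Im z * complex.Im w.
Proof. by case: z; case: w. Qed.

Lemma cImM (R : realType) (z w : R[i]) : complex.Im (z * w) =
  complex.Re z * complex.Im w + complex.Im z * complex.Re w.
Proof. by case: z; case: w. Qed.

Lemma cRe_sum (R : realType) n (f : 'I_n -> R[i]) :
  complex.Re (\sum_i f i) = \sum_i complex.Re (f i).
Proof. by apply: (big_morph (@complex.Re R)) => // -[? ?] [? ?]. Qed.

Lemma cIm_sum (R : realType) n (f : 'I_n -> R[i]) :
  complex.Im (\sum_i f i) = \sum_i complex.Im (f i).
Proof. by apply: (big_morph (@complex.Im R)) => // -[? ?] [? ?]. Qed.

Lemma cReD (R : realType) (z w : R[i]) :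
  complex.Re (z + w) = complex.Re z + complex.Re w.
Proof. by case: z; case: w. Qed.

Lemma cImD (R : realType) (z w : R[i]) :
  complex.Im (z + w) = complex.Im z + complex.Im w.
Proof. by case: z; case: w. Qed.

Lemma is_derive_mul (R : realType) (f g : R -> R) (x df dg : R) :
  is_derive x 1 f df -> is_derive x 1 g dg ->
  is_derive x 1 (fun y => f y * g y) (df * g x + f x * dg).
Proof.
move=> hf hg.
have -> : df * g x + f x * dg = f x *: dg + g x *: df.
  by rewrite addrC (mulrC df).
exact: is_deriveM.
Qed.


Definition is_mx_derive (R : realType) p q (F : R -> 'M[R[i]]_(p, q)) (x : R)
    (L : 'M[R[i]]_(p, q)) : Prop :=
  mx_derivable F x /\ mx_derive F x = L.

Lemma is_mx_deriveP (R : realType) p q (F : R -> 'M[R[i]]_(p, q)) (x : R)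
    (L : 'M[R[i]]_(p, q)) :
  is_mx_derive F x L <-> forall i j,
    is_derive x 1 (fun y => complex.Re (F y i j)) (complex.Re (L i j)) /\
    is_derive x 1 (fun y => complex.Im (F y i j)) (complex.Im (L i j)).
Proof.
split=> [[dF <-] i j|dF].
  have [dr di] := dF i j; rewrite mxE /=.
  by split; apply: DeriveDef => //; rewrite derive1E.
split=> [i j|]; first by have [[? _] [? _]] := dF i j.
apply/matrixP => i j; rewrite mxE; have [dr di] := dF i j.
by rewrite !derive1E !derive_val; case: (L i j).
Qed.

Lemma is_mx_derive_eq (R : realType) p q (F : R -> 'M[R[i]]_(p, q)) (x : R)
    (L L' : 'M[R[i]]_(p, q)) :
  is_mx_derive F x L -> L = L' -> is_mx_derive F x L'.
Proof. by move=> ? <-. Qed.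

Lemma is_mx_derive_unique (R : realType) p q (F : R -> 'M[R[i]]_(p, q)) (x : R)
    (L L' : 'M[R[i]]_(p, q)) :
  is_mx_derive F x L -> is_mx_derive F x L' -> L = L'.
Proof. by move=> [_ <-] [_ <-]. Qed.

Lemma is_mx_derive_near (R : realType) p q (F G : R -> 'M[R[i]]_(p, q)) (x : R)
    (L : 'M[R[i]]_(p, q)) :
  (\forall y \near x, F y = G y) -> is_mx_derive F x L -> is_mx_derive G x L.
Proof.
move=> FG /is_mx_deriveP dF; apply/is_mx_deriveP => i j.
have [dr di] := dF i j; split.
  by apply: (near_eq_is_derive _ dr); apply: filterS FG => y ->.
by apply: (near_eq_is_derive _ di); apply: filterS FG => y ->.
Qed.

Lemma is_mx_derive_cst (R : realType) p q (M : 'M[R[i]]_(p, q)) (x : R) :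
  is_mx_derive (fun=> M) x 0.
Proof.
by apply/is_mx_deriveP => i j; rewrite mxE; split; apply: is_derive_cst.
Qed.

Lemma is_mx_deriveD (R : realType) p q (F G : R -> 'M[R[i]]_(p, q)) (x : R)
    (L M : 'M[R[i]]_(p, q)) :
  is_mx_derive F x L -> is_mx_derive G x M ->
  is_mx_derive (fun y => F y + G y) x (L + M).
Proof.
move=> /is_mx_deriveP dF /is_mx_deriveP dG; apply/is_mx_deriveP => i j.
have [rF mF] := dF i j; have [rG mG] := dG i j; rewrite mxE; split.
  rewrite (_ : (fun y => _) = (fun y => complex.Re (F y i j)) +
    (fun y => complex.Re (G y i j))); last first.
    by apply/funext => y; rewrite mxE; apply: cReD.
  rewrite (_ : complex.Re _ = complex.Re (L i j) + complex.Re (M i j)).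
    exact: is_deriveD.
  exact: cReD.
rewrite (_ : (fun y => _) = (fun y => complex.Im (F y i j)) +
  (fun y => complex.Im (G y i j))); last first.
  by apply/funext => y; rewrite mxE; apply: cImD.
rewrite (_ : complex.Im _ = complex.Im (L i j) + complex.Im (M i j)).
  exact: is_deriveD.
exact: cImD.
Qed.

Lemma is_mx_derive_mulmx (R : realType) p q r (F : R -> 'M[R[i]]_(p, q))
    (G : R -> 'M[R[i]]_(q, r)) (x : R) (L : 'M[R[i]]_(p, q))
    (M : 'M[R[i]]_(q, r)) :
  is_mx_derive F x L -> is_mx_derive G x M ->
  is_mx_derive (fun y => F y *m G y) x (L *m G x + F x *m M).
Proof.
move=> /is_mx_deriveP dF /is_mx_deriveP dG; apply/is_mx_deriveP => i k.
rewrite !mxE -big_split /=; split.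
  rewrite (_ : (fun y => _) = \sum_j
     ((fun y => complex.Re (F y i j) * complex.Re (G y j k)) +
      - (fun y => complex.Im (F y i j) * complex.Im (G y j k)))).
    rewrite cRe_sum; apply: is_derive_sum => j.
    have [rF mF] := dF i j; have [rG mG] := dG j k.
    rewrite (_ : complex.Re _ =
        (complex.Re (L i j) * complex.Re (G x j k) +
         complex.Re (F x i j) * complex.Re (M j k)) +
        - (complex.Im (L i j) * complex.Im (G x j k) +
           complex.Im (F x i j) * complex.Im (M j k))).
      by apply: is_deriveD; [|apply: is_deriveN]; apply: is_derive_mul.
    rewrite cReD !cReM; ring.
  apply/funext => y; rewrite mxE cRe_sum fct_sumE.
  by apply: eq_bigr => j _; rewrite cReM.
rewrite (_ : (fun y => _) = \sum_j
   ((fun y => complex.Re (F y i j) * complex.Im (G y j k)) +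
    (fun y => complex.Im (F y i j) * complex.Re (G y j k)))).
  rewrite cIm_sum; apply: is_derive_sum => j.
  have [rF mF] := dF i j; have [rG mG] := dG j k.
  rewrite (_ : complex.Im _ =
      (complex.Re (L i j) * complex.Im (G x j k) +
       complex.Re (F x i j) * complex.Im (M j k)) +
      (complex.Im (L i j) * complex.Re (G x j k) +
       complex.Im (F x i j) * complex.Re (M j k))).
    by apply: is_deriveD; apply: is_derive_mul.
  rewrite cImD !cImM; ring.
apply/funext => y; rewrite mxE cIm_sum fct_sumE.
by apply: eq_bigr => j _; rewrite cImM.
Qed.

Lemma is_mx_deriveMl (R : realType) p q r (C : 'M[R[i]]_(p, q))
    (G : R -> 'M[R[i]]_(q, r)) (x : R) (M : 'M[R[i]]_(q, r)) :
  is_mx_derive G x M -> is_mx_derive (fun y => C *m G y) x (C *m M).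
Proof.
move=> /(is_mx_derive_mulmx (is_mx_derive_cst C x)) /is_mx_derive_eq; apply.
by rewrite mul0mx add0r.
Qed.

Lemma is_mx_deriveMr (R : realType) p q r (C : 'M[R[i]]_(q, r))
    (G : R -> 'M[R[i]]_(p, q)) (x : R) (M : 'M[R[i]]_(p, q)) :
  is_mx_derive G x M -> is_mx_derive (fun y => G y *m C) x (M *m C).
Proof.
move=> /is_mx_derive_mulmx /(_ (is_mx_derive_cst C x)) /is_mx_derive_eq; apply.
by rewrite mulmx0 addr0.
Qed.

Lemma is_mx_deriveN (R : realType) p q (F : R -> 'M[R[i]]_(p, q)) (x : R)
    (L : 'M[R[i]]_(p, q)) :
  is_mx_derive F x L -> is_mx_derive (fun y => - F y) x (- L).
Proof.
move=> /(is_mx_deriveMl (- 1%:M)); rewrite mulNmx mul1mx.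
by rewrite (_ : (fun y => _) = (fun y => - F y)) //; apply/funext => y;
  rewrite mulNmx mul1mx.
Qed.

Lemma is_mx_deriveB (R : realType) p q (F G : R -> 'M[R[i]]_(p, q)) (x : R)
    (L M : 'M[R[i]]_(p, q)) :
  is_mx_derive F x L -> is_mx_derive G x M ->
  is_mx_derive (fun y => F y - G y) x (L - M).
Proof. by move=> dF /is_mx_deriveN; apply: is_mx_deriveD. Qed.

Lemma is_mx_derive_adjoint (R : realType) p q (F : R -> 'M[R[i]]_(p, q))
    (x : R) (L : 'M[R[i]]_(p, q)) :
  is_mx_derive F x L -> is_mx_derive (fun y => (F y)^t*) x (L^t*).
Proof.
move=> /is_mx_deriveP dF; apply/is_mx_deriveP => i j.
have [rF mF] := dF j i; rewrite !mxE; split.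
  rewrite (_ : complex.Re _ = complex.Re (L j i)); last by case: (L j i).
  rewrite (_ : (fun y => _) = (fun y => complex.Re (F y j i))) //.
  by apply/funext => y; rewrite !mxE; case: (F y j i).
rewrite (_ : complex.Im _ = - complex.Im (L j i)); last by case: (L j i).
rewrite (_ : (fun y => _) = - (fun y => complex.Im (F y j i))).
  exact: is_deriveN.
apply/funext => y; rewrite !mxE -[RHS]/(- complex.Im (F y j i)).
by case: (F y j i).
Qed.

Lemma is_mx_derive_mxsub (R : realType) p q p' q' (f : 'I_p' -> 'I_p)
    (g : 'I_q' -> 'I_q) (F : R -> 'M[R[i]]_(p, q)) (x : R)
    (L : 'M[R[i]]_(p, q)) :
  is_mx_derive F x L -> is_mx_derive (fun y => mxsub f g (F y)) x (mxsub f g L).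
Proof.
move=> /is_mx_deriveP dF; apply/is_mx_deriveP => i j; rewrite mxE.
have [rF mF] := dF (f i) (g j); split.
  rewrite (_ : (fun y => _) = (fun y => complex.Re (F y (f i) (g j)))) //.
  by apply/funext => y; rewrite mxE.
rewrite (_ : (fun y => _) = (fun y => complex.Im (F y (f i) (g j)))) //.
by apply/funext => y; rewrite mxE.
Qed.

(** Differentiability comes from Cramer's rule; the value of the derivative is
    then forced by differentiating [invmx S *m S = 1%:M]. *)
Lemma is_mx_derive_invmx (R : realType) n (S : R -> 'M[R[i]]_n) (x : R)
    (L : 'M[R[i]]_n) :
  (\forall y \near x, S y \in unitmx) -> is_mx_derive S x L ->
  is_mx_derive (fun y => invmx (S y)) x (- (invmx (S x) *m L *m invmx (S x))).
Proof.
move=> Su dS.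
have [L' dL'] : exists L', is_mx_derive (fun y => invmx (S y)) x L'.
  exists (mx_derive (fun y => (\det (S y))^-1 *: \adj (S y)) x).
  apply: (@is_mx_derive_near _ _ _ (fun y => (\det (S y))^-1 *: \adj (S y))).
    by apply: filterS Su => y; apply: cramer_invmx.
  split=> //; apply: (entrywise_cramer (derivable_function_algebra x)).
    by case: dS.
  by move=> y ->; apply: nbhs_singleton Su.
apply: (is_mx_derive_eq dL').
have Sxu : S x \in unitmx by apply: nbhs_singleton Su.
have d1 : is_mx_derive (fun y => invmx (S y) *m S y) x 0.
  apply: (is_mx_derive_near _ (is_mx_derive_cst 1%:M x)).
  by apply: filterS Su => y yu; rewrite mulVmx.
have /(is_mx_derive_unique d1)/esym/eqP := is_mx_derive_mulmx dL' dS.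
rewrite addr_eq0 => /eqP/(congr1 (mulmx^~ (invmx (S x)))).
by rewrite mulmxK // mulNmx.
Qed.

(** * First order systems *)

(** Caratheodory solutions with a continuous right-hand side are classical. *)
Lemma solves_ode_is_mx_derive (R : realType) p q (F G : R -> 'M[R[i]]_(p, q)) :
  solves_ode F G -> mx_locally_ac setT G -> forall x, is_mx_derive F x (G x).
Proof.
move=> [acF dF] acG x; apply/is_mx_deriveP => i j; split.
  apply: (ac_is_derive (g := fun y => complex.Re (G y i j))).
  - by move=> a b ab; have [] := acF a b ab (@subsetT _ _) i j.
  - apply: filterS dF => y [dFy eFy]; have [? _] := dFy i j; split=> //.
    by rewrite -eFy mxE.
  - by apply: ac_continuous => a b ab; have [] := acG a b ab (@subsetT _ _) i j.
apply: (ac_is_derive (g := fun y => complex.Im (G y i j))).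
- by move=> a b ab; have [] := acF a b ab (@subsetT _ _) i j.
- apply: filterS dF => y [dFy eFy]; have [_ ?] := dFy i j; split=> //.
  by rewrite -eFy mxE.
- by apply: ac_continuous => a b ab; have [] := acG a b ab (@subsetT _ _) i j.
Qed.

Lemma ac_derive0_cst (R : realType) (f : R -> R) :
  (forall a b, a <= b -> absolutely_continuous a b f) ->
  {ae @lebesgue_measure R, forall x, derivable f x 1 /\ derive1 f x = 0} ->
  forall x y, f x = f y.
Proof.
move=> acf df x y; wlog xy : x y / x <= y => [hw|].
  by have [/hw|/ltW/hw/esym] := leP x y.
have /ac_increment : {ae @lebesgue_measure R, forall z, x <= z <= y ->
    derivable f z 1 /\ `|derive1 f z| <= 0}.
  by apply: filterS df => z [? ->]; rewrite normr0.
move=> /(_ xy (lexx 0) (acf _ _ xy)).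
by rewrite mul0r normr_le0 subr_eq0 => /eqP.
Qed.

Lemma mx_ode0_cst (R : realType) p q (F : R -> 'M[R[i]]_(p, q)) :
  solves_ode F (fun=> 0) -> forall x y, F x = F y.
Proof.
move=> [acF dF] x y; apply/matrixP => i j.
have eR : complex.Re (F x i j) = complex.Re (F y i j).
  apply: (@ac_derive0_cst _ (fun z => complex.Re (F z i j))).
    by move=> a b ab; have [] := acF a b ab (@subsetT _ _) i j.
  apply: filterS dF => z [dFz eFz]; have [? _] := dFz i j; split=> //.
  by have /matrixP/(_ i j) := eFz; rewrite !mxE => -[].
have eI : complex.Im (F x i j) = complex.Im (F y i j).
  apply: (@ac_derive0_cst _ (fun z => complex.Im (F z i j))).
    by move=> a b ab; have [] := acF a b ab (@subsetT _ _) i j.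
  apply: filterS dF => z [dFz eFz]; have [_ ?] := dFz i j; split=> //.
  by have /matrixP/(_ i j) := eFz; rewrite !mxE => -[].
by move: eR eI; case: (F x i j) => a b; case: (F y i j) => c d /= -> ->.
Qed.

Lemma near_unitmx (R : realType) n (S : R -> 'M[R[i]]_n) (x : R) :
  mx_locally_ac setT S -> S x \in unitmx -> \forall y \near x, S y \in unitmx.
Proof.
move=> acS Sx.
have acdet a b : a <= b -> absolutely_continuous a b
    (fun y => complex.Re (\det (S y))) /\ absolutely_continuous a b
    (fun y => complex.Im (\det (S y))).
  move=> ab.
  have acSab := acS a b ab (@subsetT _ _).
  have /(_ 0 0) := entrywise_det (ac_function_algebra ab) acSab.
  by under eq_fun do rewrite mxE eqxx;
    under [X in _ /\ absolutely_continuous _ _ X]eq_fun do rewrite mxE eqxx.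
pose n2 y := complex.Re (\det (S y)) * complex.Re (\det (S y)) +
  complex.Im (\det (S y)) * complex.Im (\det (S y)).
have n2E y : (n2 y == 0) = (\det (S y) == 0).
  rewrite /n2 -!expr2 paddr_eq0 ?sqr_ge0 // !sqrf_eq0.
  by case: (\det (S y)) => a b; rewrite eq_complex.
have cn2 : continuous n2.
  apply: ac_continuous => a b ab; have [acR acI] := acdet a b ab.
  by apply: (fa_add (ac_function_algebra ab));
    apply: (fa_mul (ac_function_algebra ab)).
have n2x : n2 x != 0 by rewrite n2E -unitfE -unitmxE.
apply: filterS (cvgr_neq0 (n2 x) (cn2 x) n2x) => y.
by rewrite n2E -unitfE -unitmxE.
Qed.

(** * The matrix exponential *)

Definition csummable (R : realType) (z : nat -> R[i]) : Prop :=
  cvgn (series (fun k => complex.Re (z k))) /\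
  cvgn (series (fun k => complex.Im (z k))).

Definition csum (R : realType) (z : nat -> R[i]) : R[i] :=
  (limn (series (fun k => complex.Re (z k))) +i*
   limn (series (fun k => complex.Im (z k))))%C.

Lemma csum_lin (R : realType) (a : R[i]) (z w : nat -> R[i]) :
  csummable z -> csummable w ->
  csummable (fun k => a * z k + w k) /\
  csum (fun k => a * z k + w k) = a * csum z + csum w.
Proof.
move=> [zr zi] [wr wi].
have cr : series (fun k => complex.Re (a * z k + w k)) @ \oo -->
    complex.Re (a * csum z + csum w).
  rewrite cReD cReM /=.
  rewrite (_ : series _ = (fun N =>
    complex.Re a * series (fun k => complex.Re (z k)) N -
    complex.Im a * series (fun k => complex.Im (z k)) N +
    series (fun k => complex.Re (w k)) N)).
    by apply: cvgD => //; apply: cvgB; apply: cvgMr.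
  apply/funext => N; rewrite /series /= !mulr_sumr -sumrB -big_split /=.
  by apply: eq_bigr => k _; rewrite cReD cReM.
have ci : series (fun k => complex.Im (a * z k + w k)) @ \oo -->
    complex.Im (a * csum z + csum w).
  rewrite cImD cImM /=.
  rewrite (_ : series _ = (fun N =>
    complex.Re a * series (fun k => complex.Im (z k)) N +
    complex.Im a * series (fun k => complex.Re (z k)) N +
    series (fun k => complex.Im (w k)) N)).
    by apply: cvgD => //; apply: cvgD; apply: cvgMr.
  apply/funext => N; rewrite /series /= !mulr_sumr -!big_split /=.
  by apply: eq_bigr => k _; rewrite cImD cImM.
split; first by split; apply/cvg_ex; eexists; eassumption.
rewrite {1}/csum (cvg_lim _ cr) // (cvg_lim _ ci) //.
by case: (a * csum z + csum w).
Qed.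

Lemma csum0 (R : realType) :
  csummable (fun=> 0 : R[i]) /\ csum (fun=> 0 : R[i]) = 0.
Proof.
have s0 : series (fun=> 0 : R) = fun=> 0.
  by apply/funext => N; rewrite /series /= big1.
rewrite /csummable /csum /= s0 lim_cst //; split=> //.
by split; exact: cvg_cst.
Qed.

Lemma csum_sum (R : realType) n (a : 'I_n -> R[i]) (z : 'I_n -> nat -> R[i]) :
  (forall l, csummable (z l)) ->
  csum (fun k => \sum_l a l * z l k) = \sum_l a l * csum (z l).
Proof.
move=> cz.
suff [] : csummable (fun k => \sum_l a l * z l k) /\
  csum (fun k => \sum_l a l * z l k) = \sum_l a l * csum (z l) by [].
elim: (index_enum _) => [|l r [IHc IHs]].
  rewrite (_ : (fun k => _) = (fun=> 0)); last first.
    by apply/funext => k; rewrite big_nil.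
  by rewrite big_nil; apply: csum0.
rewrite (_ : (fun k => _) =
  (fun k => a l * z l k + \sum_(l' <- r) a l' * z l' k)); last first.
  by apply/funext => k; rewrite big_cons.
by rewrite big_cons -IHs; apply: csum_lin.
Qed.

(** Exponential generating series with geometrically bounded coefficients: the
    term-by-term derivative merely shifts the coefficient sequence. *)
Lemma exp_series_is_derive (R : realType) (a : nat -> R) (c b t : R) :
  0 <= b -> (forall k, `|a k| <= c * b ^+ k) ->
  cvgn (series (fun k => t ^+ k / k`!%:R * a k)) /\
  is_derive t 1 (fun s => limn (series (fun k => s ^+ k / k`!%:R * a k)))
    (limn (series (fun k => t ^+ k / k`!%:R * a k.+1))).
Proof.
move=> b0 ab.
pose co (a : nat -> R) k := a k / k`!%:R.
have coE (a' : nat -> R) s : series (fun k => s ^+ k / k`!%:R * a' k) =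
    pseries (co a') s.
  rewrite /pseries; congr series; apply/funext => k; rewrite /co /=.
  by rewrite -mulrA mulrC (mulrC (a' k)).
have co_diffs a' : pseries_diffs (co a') = co (fun k => a' k.+1).
  apply/funext => k; rewrite /pseries_diffs /co factS natrM invfM.
  by rewrite mulrCA mulVKf.
have cv (a' : nat -> R) c' s : (forall k, `|a' k| <= c' * b ^+ k) ->
    cvgn (pseries (co a') s).
  move=> ab'; apply: normed_cvg; rewrite /normed_series_of /=.
  have c'0 : 0 <= c' by have := ab' 0%N; rewrite mulr1; apply: le_trans.
  apply: (@series_le_cvg _ _ (fun k => c' *: exp_coeff (b * `|s|) k)) => //.
  - by move=> k; rewrite mulr_ge0 // exp_coeff_ge0 // mulr_ge0.
  - move=> k; rewrite /co /exp_coeff /= normrM normrX normrM normfV.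
    rewrite [`|k`!%:R|]ger0_norm // exprMn.
    rewrite [_ *: _]mulrA -mulrA (mulrC (_^-1)) mulrA ler_wpM2r ?invr_ge0 //.
    by rewrite mulrA ler_wpM2r ?exprn_ge0.
  - by apply: is_cvg_seriesZ; apply: is_cvg_series_exp_coeff.
have ab1 k : `|a k.+1| <= (c * b) * b ^+ k by rewrite -mulrA -exprS.
have ab2 k : `|a k.+2| <= (c * b * b) * b ^+ k.
  by rewrite -!mulrA -!exprS.
split; first by rewrite coE; apply: cv ab.
rewrite coE -co_diffs.
rewrite (_ : (fun s => _) = (fun s => limn (pseries (co a) s))); last first.
  by apply/funext => s; rewrite coE.
apply: (@pseries_snd_diffs _ _ (`|t| + 1)).
- exact: cv ab.
- by rewrite co_diffs; apply: cv ab1.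
- by rewrite !co_diffs; apply: cv ab2.
- by rewrite [ltRHS]ger0_norm ?ltrDl ?addr_ge0.
Qed.

(** Powers grow at most geometrically because the sum of [|Re| + |Im|] over all
    entries is submultiplicative. *)
Lemma mx_pow_bounded (R : realType) n (B : 'M[R[i]]_n) :
  exists c b : R, 0 <= b /\ forall k i j,
    `|complex.Re ((B ^+ k) i j)| <= c * b ^+ k /\
    `|complex.Im ((B ^+ k) i j)| <= c * b ^+ k.
Proof.
pose nz (z : R[i]) : R := `|complex.Re z| + `|complex.Im z|.
have nz_ge0 z : 0 <= nz z by rewrite addr_ge0.
have nzM z w : nz (z * w) <= nz z * nz w.
  rewrite /nz cReM cImM mulrDl !mulrDr -!normrM.
  apply: le_trans (lerD (ler_normB _ _) (ler_normD _ _)) _.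
  lra.
pose nm m p (M : 'M[R[i]]_(m, p)) : R := \sum_l \sum_j nz (M l j).
have nm_ge0 m p (M : 'M[R[i]]_(m, p)) : 0 <= nm _ _ M.
  by apply: sumr_ge0 => ? _; apply: sumr_ge0.
have le_nm m p (M : 'M[R[i]]_(m, p)) l j : nz (M l j) <= nm _ _ M.
  rewrite /nm (bigD1 l) //= (bigD1 j) //= -addrA lerDl addr_ge0 //.
    by apply: sumr_ge0.
  by apply: sumr_ge0 => ? _; apply: sumr_ge0.
have row_le_nm (M : 'M[R[i]]_n) l : \sum_j nz (M l j) <= nm _ _ M.
  rewrite /nm [leRHS](bigD1 l) //= lerDl.
  by apply: sumr_ge0 => ? _; apply: sumr_ge0.
have nz_sum (f : 'I_n -> R[i]) : nz (\sum_j f j) <= \sum_j nz (f j).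
  rewrite /nz cRe_sum cIm_sum big_split /=.
  by apply: lerD; apply: ler_norm_sum.
have nmM (M N : 'M[R[i]]_n) : nm _ _ (M *m N) <= nm _ _ M * nm _ _ N.
  rewrite /nm mulr_suml; apply: ler_sum => l _.
  apply: (@le_trans _ _ (\sum_k \sum_j nz (M l j) * nz (N j k))).
    apply: ler_sum => k _; rewrite mxE; apply: le_trans (nz_sum _) _.
    by apply: ler_sum => j _; apply: nzM.
  rewrite exchange_big mulr_suml; apply: ler_sum => j _ /=.
  by rewrite -mulr_sumr ler_wpM2l // row_le_nm.
have bound k : nm _ _ (B ^+ k) <= nm _ _ (1%:M : 'M[R[i]]_n) * nm _ _ B ^+ k.
  elim: k => [|k IH]; first by rewrite !expr0 mulr1.
  rewrite !exprSr -mulmxE mulrA; apply: le_trans (nmM _ _) _.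
  by rewrite ler_wpM2r.
exists (nm _ _ (1%:M : 'M[R[i]]_n)), (nm _ _ B); split=> // k i j.
have := le_trans (le_nm _ _ (B ^+ k) i j) (bound k); rewrite /nz => h.
by split; apply: le_trans h; rewrite ?lerDl ?lerDr.
Qed.

Lemma mx_exp_entry (R : realType) n (B : 'M[R[i]]_n) (t : R) i j :
  mx_exp (t%:C%C *: B) i j =
  csum (fun k => (t ^+ k / k`!%:R)%:C%C * (B ^+ k) i j).
Proof.
have expr_scale k : (t%:C%C *: B) ^+ k = (t ^+ k)%:C%C *: B ^+ k.
  elim: k => [|k IH]; first by rewrite !expr0 scale1r.
  by rewrite !exprS IH -!mulmxE -scalemxAl -scalemxAr scalerA rmorphM.
rewrite mxE -[LHS]/(csum (fun k =>
  ((k`!%:R : R[i])^-1 *: (t%:C%C *: B) ^+ k) i j)); congr csum.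
apply/funext => k; rewrite expr_scale !mxE mulrA; congr (_ * _).
by rewrite mulrC rmorphM fmorphV rmorph_nat.
Qed.

(** Term by term: the derivative shifts the coefficients [B ^+ k] of the series
    to [B *m B ^+ k]. *)
Lemma is_mx_derive_exp (R : realType) n (B : 'M[R[i]]_n) (t : R) :
  is_mx_derive (fun s => mx_exp (s%:C%C *: B)) t (B *m mx_exp (t%:C%C *: B)).
Proof.
have ReZ (r : R) (z : R[i]) : complex.Re (r%:C%C * z) = r * complex.Re z.
  by rewrite cReM /= mul0r subr0.
have ImZ (r : R) (z : R[i]) : complex.Im (r%:C%C * z) = r * complex.Im z.
  by rewrite cImM /= mul0r addr0.
have [c [b [b0 cb]]] := mx_pow_bounded B.
have cbR l j k : `|complex.Re ((B ^+ k) l j)| <= c * b ^+ k.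
  by have [] := cb k l j.
have cbI l j k : `|complex.Im ((B ^+ k) l j)| <= c * b ^+ k.
  by have [] := cb k l j.
have termR s l j k' : (fun k => complex.Re ((s ^+ k / k`!%:R)%:C%C *
    (B ^+ (k' + k)) l j)) =
    (fun k => s ^+ k / k`!%:R * complex.Re ((B ^+ (k' + k)) l j)).
  by apply/funext => k; rewrite ReZ.
have termI s l j k' : (fun k => complex.Im ((s ^+ k / k`!%:R)%:C%C *
    (B ^+ (k' + k)) l j)) =
    (fun k => s ^+ k / k`!%:R * complex.Im ((B ^+ (k' + k)) l j)).
  by apply/funext => k; rewrite ImZ.
have summable l j :
    csummable (fun k => (t ^+ k / k`!%:R)%:C%C * (B ^+ k) l j).
  split; first by rewrite (termR _ _ _ 0%N);
    have [] := exp_series_is_derive t b0 (cbR l j).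
  by rewrite (termI _ _ _ 0%N); have [] := exp_series_is_derive t b0 (cbI l j).
apply/is_mx_deriveP => i j.
have -> : (B *m mx_exp (t%:C%C *: B)) i j =
    csum (fun k => (t ^+ k / k`!%:R)%:C%C * (B ^+ k.+1) i j).
  rewrite mxE; under eq_bigr do rewrite mx_exp_entry.
  rewrite -csum_sum //; congr csum; apply/funext => k.
  rewrite exprS mxE mulr_sumr; apply: eq_bigr => l _.
  by rewrite mulrCA.
rewrite /csum /= (termR _ _ _ 1%N) (termI _ _ _ 1%N); split.
  rewrite (_ : (fun s => _) = (fun s => limn (series (fun k =>
      s ^+ k / k`!%:R * complex.Re ((B ^+ k) i j))))).
    by have [] := exp_series_is_derive t b0 (cbR i j).
  by apply/funext => s; rewrite mx_exp_entry /csum /= (termR _ _ _ 0%N).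
rewrite (_ : (fun s => _) = (fun s => limn (series (fun k =>
    s ^+ k / k`!%:R * complex.Im ((B ^+ k) i j))))).
  by have [] := exp_series_is_derive t b0 (cbI i j).
by apply/funext => s; rewrite mx_exp_entry /csum /= (termI _ _ _ 0%N).
Qed.

(** * The algebra of the transformation *)

Lemma adjoint_mulmx (R : realType) p q r (A : 'M[R[i]]_(p, q))
    (B : 'M[R[i]]_(q, r)) : (A *m B)^t* = B^t* *m A^t*.
Proof. by rewrite trmx_mul map_mxM. Qed.

Lemma adjointK (R : realType) p q (A : 'M[R[i]]_(p, q)) : (A^t*)^t* = A.
Proof. by apply/matrixP => i j; rewrite !mxE conjCK. Qed.

Lemma adjointD (R : realType) p q (A B : 'M[R[i]]_(p, q)) :
  (A + B)^t* = A^t* + B^t*.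
Proof. by rewrite linearD /= map_mxD. Qed.

Lemma adjointN (R : realType) p q (A : 'M[R[i]]_(p, q)) : (- A)^t* = - A^t*.
Proof. by rewrite linearN /= map_mxN. Qed.

Lemma adjoint_invmx (R : realType) n (A : 'M[R[i]]_n) :
  (invmx A)^t* = invmx (A^t*).
Proof. by rewrite trmx_inv map_invmx. Qed.

Lemma adjoint_row_mx (R : realType) p q r (A : 'M[R[i]]_(p, q))
    (B : 'M[R[i]]_(p, r)) : (row_mx A B)^t* = col_mx (A^t*) (B^t*).
Proof. by rewrite tr_row_mx map_col_mx. Qed.

(** Here [A'], [Q1], [Q2], [Z] stand for [A^*], [P1^*], [P2^*], [S^-1]. Keeping
    them as independent matrices over a commutative ring frees the computation
    from conjugation. *)
Section SchrodingerAlgebra.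
Variables (F : comNzRingType) (h n : nat) (A A' S Z : 'M[F]_n).
Variables (P1 P2 : 'M[F]_(n, h)) (Q1 Q2 : 'M[F]_(h, n)) (u : 'M[F]_h).

(** The two sides of [A S - S A^* = Pi j Pi^*] have equal derivatives. *)
Lemma identity_derivative :
  A *m (P2 *m Q2) - P2 *m Q2 *m A' =
  (A *m P2 - P2 *m u) *m Q2 + P1 *m - Q1 -
  (- P1 *m Q1 + P2 *m (Q2 *m A' - u *m Q2)).
Proof.
rewrite !(mulmxBl, mulmxBr) !(mulmxN, mulNmx) !mulmxA.
apply/matrixP => i j; rewrite !mxE; ring.
Qed.

Hypothesis ZS : Z *m S = 1%:M.
Hypothesis SZ : S *m Z = 1%:M.
Hypothesis identity : A *m S - S *m A' = P1 *m Q2 - P2 *m Q1.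

Let Y1 := Q1 *m Z.
Let Y2 := Q2 *m Z.

(* The identity multiplied by [Z] on both sides. *)
Let intertwine : A' *m Z = Z *m A - Z *m P1 *m Y2 + Z *m P2 *m Y1.
Proof.
have ZA : Z *m A - A' *m Z = Z *m P1 *m Y2 - Z *m P2 *m Y1.
  rewrite /Y1 /Y2 !mulmxA -mulmxBl -[Z *m P1 *m Q2]mulmxA.
  rewrite -[Z *m P2 *m Q1]mulmxA -mulmxBr -identity mulmxBr mulmxBl.
  by rewrite -[Z *m (A *m S) *m Z]mulmxA -(mulmxA A) SZ mulmx1 mulmxA ZS mul1mx.
by rewrite -[LHS](subKr (Z *m A)) ZA opprB addrA addrAC.
Qed.

(** The terms not involving the potential are [- Y2''], in the shape that the
    product rule produces from [Y2' = - (Y1 + Y2 P2 Y2)]. Once [A'] is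
    eliminated by [intertwine], all terms containing [P1] or [P2] cancel. *)
Lemma schrodinger_algebra :
  ((Q2 *m A' - u *m Q2) *m Z + Q1 *m - (Z *m (P2 *m Q2) *m Z) +
   ((- (Y1 + Y2 *m P2 *m Y2) *m P2 + Y2 *m - P1) *m Y2 +
    Y2 *m P2 *m - (Y1 + Y2 *m P2 *m Y2))) +
  (u + 2%:R *: (Y1 *m P2 + Y2 *m P1 + Y2 *m P2 *m (Y2 *m P2))) *m Y2 =
  Y2 *m A.
Proof.
have -> : (Q2 *m A' - u *m Q2) *m Z =
    Y2 *m A - Y2 *m P1 *m Y2 + Y2 *m P2 *m Y1 - u *m Y2.
  rewrite mulmxBl -!(mulmxA _ _ Z) -/Y2 intertwine mulmxDr mulmxBr.
  by rewrite !(mulmxA Q2) -/Y2.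
have -> : Q1 *m - (Z *m (P2 *m Q2) *m Z) = - (Y1 *m P2 *m Y2).
  by rewrite mulmxN /Y1 /Y2 !mulmxA.
rewrite !(mulmxDl, mulmxDr, mulmxN, mulNmx) -scalemxAl !mulmxDl !mulmxA.
move: (Y2 *m A) (Y2 *m P1 *m Y2) (Y2 *m P2 *m Y1) (u *m Y2) (Y1 *m P2 *m Y2)
  (Y2 *m P2 *m Y2 *m P2 *m Y2) => a b c d e f.
apply/matrixP => i j; rewrite !mxE; ring.
Qed.
End SchrodingerAlgebra.

(** * The dressed Schrodinger equation *)

Lemma entrywise_ac_eq_on (R : realType) (a b : R) p q
    (F G : R -> 'M[R[i]]_(p, q)) : (forall x, a <= x <= b -> F x = G x) ->
  entrywise (absolutely_continuous a b) F ->
  entrywise (absolutely_continuous a b) G.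
Proof.
move=> FG acF i j; have [acR acI] := acF i j.
by split; [apply: ac_eq_on acR | apply: ac_eq_on acI] => x x_ab; rewrite FG.
Qed.

(** [Y1] and [Y2] of the proof sketch, for [P = P1] and [P = P2]. *)
Definition dressed (R : realType) (h n : nat) (P : R -> 'M[R[i]]_(n, h))
    (S : R -> 'M[R[i]]_n) (x : R) : 'M[R[i]]_(h, n) :=
  (P x)^t* *m invmx (S x).

(** Minus the derivative of [dressed P2 S], when [P2' = - P1] and
    [S' = P2 P2^*]. *)
Definition dressed_slope (R : realType) (h n : nat)
    (P1 P2 : R -> 'M[R[i]]_(n, h)) (S : R -> 'M[R[i]]_n) (x : R) :
    'M[R[i]]_(h, n) :=
  dressed P1 S x + dressed P2 S x *m P2 x *m dressed P2 S x.

Definition dressed_potential (R : realType) (h n : nat) (u : R -> 'M[R[i]]_h)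
    (P1 P2 : R -> 'M[R[i]]_(n, h)) (S : R -> 'M[R[i]]_n) (x : R) :
    'M[R[i]]_h :=
  u x + 2%:R *: (dressed P1 S x *m P2 x + dressed P2 S x *m P1 x +
    dressed P2 S x *m P2 x *m (dressed P2 S x *m P2 x)).

Section DressedSchrodinger.
Variables (R : realType) (h n : nat) (u : R -> 'M[R[i]]_h) (A : 'M[R[i]]_n).
Variables (P1 P2 : R -> 'M[R[i]]_(n, h)) (S : R -> 'M[R[i]]_n).
Local Notation Z := (fun x => invmx (S x)).
Local Notation Y1 := (dressed P1 S).
Local Notation Y2 := (dressed P2 S).
Local Notation W := (dressed_slope P1 P2 S).
Local Notation v := (dressed_potential u P1 P2 S).

Hypothesis u_herm : forall x, (u x)^t* = u x.
Hypothesis S0_herm : (S 0)^t* = S 0.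
Hypothesis identity0 :
  A *m S 0 - S 0 *m A^t* = P1 0 *m (P2 0)^t* - P2 0 *m (P1 0)^t*.
Hypothesis P1_ode : solves_ode P1 (fun x => A *m P2 x - P2 x *m u x).
Hypothesis P2_ode : solves_ode P2 (fun x => - P1 x).
Hypothesis S_ode : solves_ode S (fun x => P2 x *m (P2 x)^t*).

Let acP1 (a b : R) : a <= b -> entrywise (absolutely_continuous a b) P1.
Proof. by move=> ab; apply: P1_ode.1 => //; apply: subsetT. Qed.

Let acP2 (a b : R) : a <= b -> entrywise (absolutely_continuous a b) P2.
Proof. by move=> ab; apply: P2_ode.1 => //; apply: subsetT. Qed.

Let acS (a b : R) : a <= b -> entrywise (absolutely_continuous a b) S.
Proof. by move=> ab; apply: S_ode.1 => //; apply: subsetT. Qed.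

Let dP2 x : is_mx_derive P2 x (- P1 x).
Proof.
apply: (solves_ode_is_mx_derive P2_ode) => a b ab _.
exact: (entrywise_opp (ac_function_algebra ab) (acP1 ab)).
Qed.

Let dS x : is_mx_derive S x (P2 x *m (P2 x)^t*).
Proof.
apply: (solves_ode_is_mx_derive S_ode) => a b ab _.
have FA := ac_function_algebra ab.
apply: (entrywise_mulmx FA); first exact: acP2.
by apply: (entrywise_adjoint FA); apply: acP2.
Qed.

Let dQ2 x : is_mx_derive (fun y => (P2 y)^t*) x (- (P1 x)^t*).
Proof. by have := is_mx_derive_adjoint (dP2 x); rewrite adjointN. Qed.

Let dQ1 x : is_mx_derive P1 x (A *m P2 x - P2 x *m u x) ->
  is_mx_derive (fun y => (P1 y)^t*) x
    ((P2 x)^t* *m A^t* - u x *m (P2 x)^t*).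
Proof.
move=> /is_mx_derive_adjoint.
by rewrite adjointD adjointN !adjoint_mulmx u_herm.
Qed.

Lemma operator_identity x :
  A *m S x - S x *m A^t* = P1 x *m (P2 x)^t* - P2 x *m (P1 x)^t*.
Proof.
pose G y := A *m S y - S y *m A^t* -
  (P1 y *m (P2 y)^t* - P2 y *m (P1 y)^t*).
suff G_ode : solves_ode G (fun=> 0).
  apply/eqP; rewrite -subr_eq0 -/(G x) (mx_ode0_cst G_ode x 0).
  by rewrite /G identity0 subrr.
split.
  move=> a b ab _; have FA := ac_function_algebra ab.
  have acQ1 := entrywise_adjoint FA (acP1 ab).
  have acQ2 := entrywise_adjoint FA (acP2 ab).
  have acc := fun M : 'M[R[i]]_n => entrywise_cst FA M.
  have subFA p q (F H : R -> 'M[R[i]]_(p, q)) :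
      entrywise (absolutely_continuous a b) F ->
      entrywise (absolutely_continuous a b) H ->
      entrywise (absolutely_continuous a b) (fun y => F y - H y).
    by move=> acF /(entrywise_opp FA); apply: (entrywise_add FA).
  apply: (subFA); apply: (subFA); apply: (entrywise_mulmx FA).
  - exact: acc.
  - exact: acS.
  - exact: acS.
  - exact: acc.
  - exact: acP1.
  - exact: acQ2.
  - exact: acP2.
  - exact: acQ1.
apply: filterS P1_ode.2 => y dP1.
suff : is_mx_derive G y 0 by [].
have dL := is_mx_deriveB (is_mx_deriveMl A (dS y))
  (is_mx_deriveMr (A^t*) (dS y)).
have dR := is_mx_deriveB (is_mx_derive_mulmx dP1 (dQ2 y))
  (is_mx_derive_mulmx (dP2 y) (dQ1 dP1)).
apply: (is_mx_derive_eq (is_mx_deriveB dL dR)).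
by rewrite (identity_derivative _ _ (P1 y) _ ((P1 y)^t*) _ (u y)) subrr.
Qed.

Lemma S_hermitian x : (S x)^t* = S x.
Proof.
pose G y := (S y)^t* - S y.
suff G_ode : solves_ode G (fun=> 0).
  apply/eqP; rewrite -subr_eq0 -/(G x) (mx_ode0_cst G_ode x 0).
  by rewrite /G S0_herm subrr.
split.
  move=> a b ab _; have FA := ac_function_algebra ab.
  apply: (entrywise_add FA); first exact: (entrywise_adjoint FA (acS ab)).
  exact: (entrywise_opp FA (acS ab)).
apply: aeW => y.
suff : is_mx_derive G y 0 by [].
apply: (is_mx_derive_eq (is_mx_deriveB (is_mx_derive_adjoint (dS y)) (dS y))).
by rewrite adjoint_mulmx adjointK subrr.
Qed.

Lemma dressed_potential_hermitian x : v x = (v x)^t*.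
Proof.
have Zh : (invmx (S x))^t* = invmx (S x) by rewrite adjoint_invmx S_hermitian.
have two (M : 'M[R[i]]_h) : 2%:R *: M = M + M by rewrite scaler_nat mulr2n.
rewrite /dressed_potential /dressed !two !adjointD u_herm.
rewrite !adjoint_mulmx Zh !adjointK !mulmxA.
by rewrite (addrC ((P2 x)^t* *m invmx (S x) *m P1 x)).
Qed.

Let nearS x : S x \in unitmx -> \forall y \near x, S y \in unitmx.
Proof. exact: near_unitmx S_ode.1. Qed.

Let dZ x : S x \in unitmx ->
  is_mx_derive Z x (- (invmx (S x) *m (P2 x *m (P2 x)^t*) *m invmx (S x))).
Proof. by move=> Sx; apply: is_mx_derive_invmx (dS x); apply: nearS. Qed.

Let dY2 x : S x \in unitmx -> is_mx_derive Y2 x (- W x).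
Proof.
move=> Sx; apply: (is_mx_derive_eq (is_mx_derive_mulmx (dQ2 x) (dZ Sx))).
by rewrite /dressed_slope /dressed mulNmx mulmxN opprD !mulmxA.
Qed.

Lemma dressed_second_derivative x : S x \in unitmx ->
  is_mx_derive P1 x (A *m P2 x - P2 x *m u x) ->
  exists2 L, is_mx_derive W x L & L + v x *m Y2 x = Y2 x *m A.
Proof.
move=> Sx dP1.
have dY1 := is_mx_derive_mulmx (dQ1 dP1) (dZ Sx).
have dX22 := is_mx_derive_mulmx (dY2 Sx) (dP2 x).
have dW := is_mx_deriveD dY1 (is_mx_derive_mulmx dX22 (dY2 Sx)).
eexists; first exact: dW.
exact: (schrodinger_algebra (u x) (mulVmx Sx) (mulmxV Sx)
  (operator_identity x)).
Qed.

Let acZ (a b : R) : a <= b -> `[a, b] `<=` invertibility_set S ->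
  entrywise (absolutely_continuous a b) Z.
Proof.
move=> ab abD; have FA := ac_function_algebra ab.
apply: (entrywise_ac_eq_on _ (entrywise_cramer FA (acS ab) _)); last exact: abD.
by move=> x x_ab; apply: cramer_invmx; apply: abD; rewrite /= in_itv.
Qed.

Lemma dressed_schrodinger :
  solves_schrodinger (invertibility_set S) v
    (fun x t => Y2 x *m mx_exp (- ((0 +i* 1) * t%:C)%C *: A)).
Proof.
(* exp(-itA) = exp(tB), a scalar multiple of a constant matrix *)
pose B := (- (0 +i* 1)%C : R[i]) *: A.
have expE t : mx_exp (- ((0 +i* 1) * t%:C)%C *: A) = mx_exp (t%:C%C *: B).
  by rewrite /B scalerA mulrN mulrC.
rewrite (_ : (fun x t => _) = (fun x t => Y2 x *m mx_exp (t%:C%C *: B)));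
  last first.
  by apply/funext => x; apply/funext => t; rewrite expE.
set f := fun x t => _.
have df x t : S x \in unitmx ->
    is_mx_derive (fun y => f y t) x (- W x *m mx_exp (t%:C%C *: B)).
  by move=> Sx; apply: is_mx_deriveMr; apply: dY2.
have acY (a b : R) : a <= b -> `[a, b] `<=` invertibility_set S ->
    entrywise (absolutely_continuous a b) Y1 /\
    entrywise (absolutely_continuous a b) Y2.
  move=> ab abD; have FA := ac_function_algebra ab.
  split; apply: (entrywise_mulmx FA (entrywise_adjoint FA _) (acZ ab abD)).
    exact: acP1.
  exact: acP2.
have dft x t : is_mx_derive (f x) t (Y2 x *m (B *m mx_exp (t%:C%C *: B))).
  by apply: is_mx_deriveMl; apply: is_mx_derive_exp.
split.
- move=> t a b ab abD; have FA := ac_function_algebra ab.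
  apply: (entrywise_mulmx FA); first by have [] := acY _ _ ab abD.
  exact: (entrywise_cst FA).
- by move=> x t Sx; have [] := df x t Sx.
- move=> t a b ab abD; have FA := ac_function_algebra ab.
  apply: (@entrywise_ac_eq_on _ _ _ _ _
    (fun x => - W x *m mx_exp (t%:C%C *: B))).
    move=> x x_ab; have Sx : S x \in unitmx by apply: abD; rewrite /= in_itv.
    by rewrite /d_dx (df x t Sx).2.
  have [acY1 acY2] := acY _ _ ab abD.
  apply: (entrywise_mulmx FA); last exact: (entrywise_cst FA).
  apply: (entrywise_opp FA); apply: (entrywise_add FA) => //.
  apply: (entrywise_mulmx FA) => //.
  by apply: (entrywise_mulmx FA) => //; apply: acP2.
- by move=> x t _; have [] := dft x t.
apply: filterS P1_ode.2 => x dP1 Sx t.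
have [L dW LE] := dressed_second_derivative Sx dP1.
have d2 : is_mx_derive (fun y => d_dx f y t) x (- L *m mx_exp (t%:C%C *: B)).
  apply: (@is_mx_derive_near _ _ _ (fun y => - W y *m mx_exp (t%:C%C *: B))).
    by apply: filterS (nearS Sx) => y Sy; rewrite /d_dx (df y t Sy).2.
  by apply: is_mx_deriveMr; apply: is_mx_deriveN.
split; first exact: d2.1.
rewrite /d_dt (dft x t).2 /schrodinger_op {1}/d_dx d2.2.
rewrite mulNmx opprK /f (mulmxA (Y2 x)) (mulmxA (v x)) -mulmxDl LE.
rewrite scalemxAl; congr (_ *m _).
rewrite /B -scalemxAr scalerA mulrN -expr2 sqr_i opprK scale1r.
by [].
Qed.
End DressedSchrodinger.

Lemma solves_ode_mxsub (R : realType) p q p' q' (f : 'I_p' -> 'I_p)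
    (g : 'I_q' -> 'I_q) (F G : R -> 'M[R[i]]_(p, q)) :
  solves_ode F G ->
  solves_ode (fun x => mxsub f g (F x)) (fun x => mxsub f g (G x)).
Proof.
move=> [acF dF]; split.
  move=> a b ab abD; exact: (entrywise_mxsub f g (acF a b ab abD)).
by apply: filterS dF => x; apply: is_mx_derive_mxsub.
Qed.

Lemma solves_ode_eq (R : realType) p q (F F' G G' : R -> 'M[R[i]]_(p, q)) :
  (forall x, F x = F' x) -> (forall x, G x = G' x) ->
  solves_ode F G -> solves_ode F' G'.
Proof.
by move=> /funext -> /funext ->.
Qed.

Theorem theorem3p1 (R : realType) (h n : nat)
    (u : R -> 'M[R[i]]_h)
    (u_herm : forall x, u x = (u x)^t*)
    (u_summable : entrywise (@locally_summable R) u)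
    (A : 'M[R[i]]_n)
    (Pi : R -> 'M[R[i]]_(n, h + h)) (S : R -> 'M[R[i]]_n)
    (S0_herm : S 0 = (S 0)^t*)
    (identity0 : A *m S 0 - S 0 *m A^t* = Pi 0 *m mx_j R h *m (Pi 0)^t*)
    (Pi_ode : solves_ode Pi
       (fun x => A *m Pi x *m mx_q1 R h + Pi x *m mx_q0 u x))
    (S_ode : solves_ode S
       (fun x => Pi x *m mx_q1 R h *m mx_j R h *m (Pi x)^t*)) :
  solves_schrodinger (invertibility_set S) (u_tilde u Pi S) (psi A Pi S) /\
  (forall x, invertibility_set S x ->
     u_tilde u Pi S x = (u_tilde u Pi S x)^t*).
Proof.
pose P1 x := lsubmx (Pi x); pose P2 x := rsubmx (Pi x).
have PiE x : Pi x = row_mx (P1 x) (P2 x) by rewrite hsubmxK.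
have rhsE x : A *m Pi x *m mx_q1 R h + Pi x *m mx_q0 u x =
    row_mx (A *m P2 x - P2 x *m u x) (- P1 x).
  rewrite PiE /mx_q1 /mx_q0 mulmxN mul_mx_row !mul_row_block.
  rewrite !(mulmx0, mulmx1, add0r, addr0) opp_row_mx add_row_mx add0r.
  by [].
have PjP x : Pi x *m mx_j R h *m (Pi x)^t* =
    P1 x *m (P2 x)^t* - P2 x *m (P1 x)^t*.
  rewrite PiE adjoint_row_mx /mx_j mul_row_block mul_row_col.
  by rewrite !(mulmx0, mulmx1, mulmxN, add0r, addr0) mulNmx addrC.
have P1_ode : solves_ode P1 (fun x => A *m P2 x - P2 x *m u x).
  apply: solves_ode_eq (solves_ode_mxsub id (@lshift h h) Pi_ode) => x.
    by rewrite -lsubmxEsub.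
  by rewrite -lsubmxEsub rhsE row_mxKl.
have P2_ode : solves_ode P2 (fun x => - P1 x).
  apply: solves_ode_eq (solves_ode_mxsub id (@rshift h h) Pi_ode) => x.
    by rewrite -rsubmxEsub.
  by rewrite -rsubmxEsub rhsE row_mxKr.
have S_ode2 : solves_ode S (fun x => P2 x *m (P2 x)^t*).
  apply: solves_ode_eq S_ode => x //.
  rewrite PiE adjoint_row_mx /mx_q1 /mx_j !mul_row_block mul_row_col.
  by rewrite !(mulmx0, mulmx1, mul0mx, add0r, addr0, oppr0).
have uh x : (u x)^t* = u x by rewrite -u_herm.
have uE x : u_tilde u Pi S x = dressed_potential u P1 P2 S x.
  have XE : mx_X Pi S x = block_mx
      ((P1 x)^t* *m invmx (S x) *m P1 x) ((P1 x)^t* *m invmx (S x) *m P2 x)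
      ((P2 x)^t* *m invmx (S x) *m P1 x) ((P2 x)^t* *m invmx (S x) *m P2 x).
    by rewrite /mx_X PiE adjoint_row_mx mul_col_mx mul_col_row.
  by rewrite /u_tilde XE block_mxKur block_mxKdl block_mxKdr.
have psiE x t : psi A Pi S x t =
    dressed P2 S x *m mx_exp (- ((0 +i* 1) * t%:C)%C *: A).
  by rewrite /psi PiE adjoint_row_mx mul_row_col mul0mx mul1mx add0r.
have id0 : A *m S 0 - S 0 *m A^t* = P1 0 *m (P2 0)^t* - P2 0 *m (P1 0)^t*.
  by rewrite identity0 PjP.
split; last first.
  by move=> x _; rewrite uE; apply: dressed_potential_hermitian.
have -> : u_tilde u Pi S = dressed_potential u P1 P2 S.
  by apply/funext => x; exact: uE.
have -> : psi A Pi S = fun x t =>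
    dressed P2 S x *m mx_exp (- ((0 +i* 1) * t%:C)%C *: A).
  by apply/funext => x; apply/funext => t; exact: psiE.
exact: dressed_schrodinger uh id0 P1_ode P2_ode S_ode2.
Qed.
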